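(* Let $F$ be a free group and let $A$ and $B$ be finitely generated subgroups of infinite index in $F$. Then there is a subgroup $H\le B$ of finite index in $B$ such that the subgroup $\langle A,H\rangle$ has infinite index in $F$. In addition, for every finite subset $S\subset F\setminus A$, the subgroup $H$ (of finite index in $B$, with $\langle A,H\rangle$ of infinite index in $F$) can be chosen so that $\langle A,H\rangle\cap S=\emptyset$.
   Context: $\langle A,H\rangle$ denotes the subgroup of $F$ generated by $A\cup H$. *)

(* Defs.v *)
From HB Require Import structures.
From mathcomp Require Import all_boot.
From mathcomp Require Import boolp classical_sets cardinality.

Set Implicit Arguments.
Unset Strict Implicit.
Unset Printing Implicit Defensive.

Local Open Scope group_scope.
Local Open Scope classical_set_scope.

Section Subgroups.
Variable G : groupType.
Implicit Types (H K X : set G).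

Definition subgroup H : Prop := group_closed (mem H).

Definition generated X : set G := smallest subgroup X.

Definition finitely_generated H : Prop :=
  exists2 X : set G, finite_set X & H = generated X.

Definition left_cosets H K : set (set G) :=
  [set [set x * h | h in H] | x in K].

(* Meant for subgroups H `<=` K. *)
Definition finite_index H K : Prop := finite_set (left_cosets H K).

Definition infinite_index H K : Prop := infinite_set (left_cosets H K).

End Subgroups.

Section FreeGroups.
Variable F : groupType.

(* The letter (x, false) stands for x and (x, true) for its formal inverse. *)
Definition letter_val (l : F * bool) : F := if l.2 then l.1^-1 else l.1.

Definition word_val (w : seq (F * bool)) : F := \prod_(l <- w) letter_val l.

Definition cancelling (l m : F * bool) : bool := (l.1 == m.1) && (l.2 != m.2).

Definition reduced (w : seq (F * bool)) : bool :=
  sorted (fun l m => ~~ cancelling l m) w.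

Definition word_over (X : set F) (w : seq (F * bool)) : Prop :=
  forall l, l \in w -> X l.1.

Definition free_basis (X : set F) : Prop :=
  forall g : F, exists! w : seq (F * bool),
    [/\ word_over X w, reduced w & word_val w = g].

(* No restriction on the rank, which may be 0 or infinite. *)
Definition free_group : Prop := exists X : set F, free_basis X.

End FreeGroups.

(* Main.v *)
Require Import Defs.
From HB Require Import structures.
From mathcomp Require Import all_boot ssralg ssrint.
From mathcomp Require Import boolp classical_sets cardinality.

(* A subgroup H of finite index in B with <A, H> of infinite index amounts to an
   action of F with a point o fixed by A, moved by S, having a finite B-orbit
   and an infinite F-orbit: take H to be the stabiliser of o in B.  Such an
   action is glued from three pieces.
   - T: a finite set of cosets of A, large enough to read off generators of A
     and the elements of S, on which every basis element z acts by a permutation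
     extending its partial translation action.  As A has infinite index, some
     z-edge leaving some t in T is not used by these words.
   - C: a finite F-set with points c and u such that u lies outside finitely
     many prescribed sets p B q c.  It is F acting on maps from a finite
     truncation T' of the coset space of B to itself; B fixes a point of T', so
     the existence of u is a counting argument once T' is large.
   - a bi-infinite z-orbit, indexed by the integers.
   Exchanging the targets of the z-edges leaving t and c joins T to C, and the
   same operation at u inserts the infinite line.  A word of B starting in T can
   only reach points p b q c of C, hence never u, so its orbit stays in the
   finite set T + C. *)

Set Implicit Arguments.
Unset Strict Implicit.
Unset Printing Implicit Defensive.

Local Open Scope group_scope.
Local Open Scope classical_set_scope.

(** * Subgroups and their left cosets *)

Section Subgroups.
Context {G : groupType}.
Implicit Types (H K X : set G) (g h : G).

Lemma subgroupP H :
  subgroup H <->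
  [/\ H 1, forall g h, H g -> H h -> H (g * h) & forall g, H g -> H g^-1].
Proof.
split=> [sH|[H1 HM HV]].
  have [H1 _] := sH.
  split=> [|g h Hg Hh|g Hg]; first by rewrite inE in H1.
    by have := group_closedM sH (mem_set Hg) (mem_set Hh); rewrite inE.
  by have := group_closedV sH (mem_set Hg); rewrite inE.
split; first exact/mem_set.
move=> g h; rewrite !inE => Hg Hh; exact/HM/HV.
Qed.

Lemma left_coset_eqP H g h : subgroup H ->
  [set g * a | a in H] = [set h * a | a in H] <-> H (g^-1 * h).
Proof.
case/subgroupP=> H1 HM HV; split=> [E|Hgh].
  have : [set h * a | a in H] h by exists 1 => //; rewrite mulg1.
  by rewrite -E => -[a Ha <-]; rewrite mulKg.
apply/seteqP; split=> _ [a Ha <-].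
  exists ((g^-1 * h)^-1 * a); first by apply: HM => //; apply: HV.
  by rewrite invgM invgK !mulgA mulgV mul1g.
by exists (g^-1 * h * a); [exact: HM | rewrite !mulgA mulgV mul1g].
Qed.

End Subgroups.

(** * Actions, stabilisers and the index of subgroups *)

Section Actions.
Context {G : groupType} {V : Type}.

Definition is_action (act : G -> V -> V) : Prop :=
  (forall v, act 1 v = v) /\ (forall g h v, act (g * h) v = act g (act h v)).

Context (act : G -> V -> V) (act_action : is_action act).

Lemma act1 v : act 1 v = v. Proof. exact: act_action.1. Qed.
Lemma actM g h v : act (g * h) v = act g (act h v).
Proof. exact: act_action.2. Qed.
Lemma actK g : cancel (act g) (act g^-1).
Proof. by move=> v; rewrite -actM mulVg act1. Qed.
Lemma actVK g : cancel (act g^-1) (act g).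
Proof. by move=> v; rewrite -actM mulgV act1. Qed.

Definition stab o : set G := [set g | act g o = o].

Lemma stab_subgroup o : subgroup (stab o).
Proof.
apply/subgroupP; split=> [|g h|g]; rewrite /stab /=; first exact: act1.
  by rewrite actM => Hg ->.
by move=> E; rewrite -{1}E actK.
Qed.

(** As [M] fixes [o], sending a coset [g M] to [g o] is well defined and maps the cosets onto the
    orbit. So finitely many cosets would give a finite orbit. *)
Lemma stab_infinite_index (M : set G) o :
  M 1 -> M `<=` stab o -> infinite_set [set act g o | g in setT] ->
  infinite_index M [set: G].
Proof.
move=> M1 Mo infO finM; apply: infO.
apply: sub_finite_set (finite_image (fun Y => act (xget 1 Y) o) finM).
move=> _ [g _ <-]; exists [set g * h | h in M]; first by exists g.
case: xgetP => [y _ [h /Mo ho <-]|/(_ g) []]; first by rewrite actM ho.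
by exists 1 => //; rewrite mulg1.
Qed.

(** The coset of [b] consists of the elements of [B] that take [o] to [b o], so it is determined by
    a point of the finite [B]-orbit. *)
Lemma stab_finite_index (B : set G) o :
  subgroup B -> finite_set [set act b o | b in B] ->
  finite_index (B `&` stab o) B.
Proof.
case/subgroupP=> B1 BM BV finO.
apply: sub_finite_set (finite_image (fun v => [set g | B g /\ act g o = v]) finO).
move=> _ [b Bb <-]; exists (act b o); first by exists b.
apply/seteqP; split=> [g [Bg Eg]|_ [g [Bg go] <-]] /=.
  exists (b^-1 * g); last by rewrite mulgA mulgV mul1g.
  split; first by apply: BM => //; apply: BV.
  by rewrite /stab /= actM Eg actK.
by split; [exact: BM | rewrite actM go].
Qed.

End Actions.

(** * Words over a basis and the universal property of free groups *)

Section FreeGroup.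
Context {F : groupType} {X : set F} (X_basis : free_basis X).

Lemma word_val_nil : word_val [::] = 1 :> F.
Proof. by rewrite /word_val big_nil. Qed.

Lemma word_val_cons (l : F * bool) w : word_val (l :: w) = letter_val l * word_val w.
Proof. by rewrite /word_val big_cons. Qed.

Lemma word_val_cat (v w : seq (F * bool)) : word_val (v ++ w) = word_val v * word_val w.
Proof.
elim: v => [|l v IH]; first by rewrite word_val_nil mul1g.
by rewrite cat_cons !word_val_cons IH mulgA.
Qed.

Lemma word_over_cons (l : F * bool) w :
  word_over X (l :: w) <-> X l.1 /\ word_over X w.
Proof.
split=> [H|[Hl Hw] m].
  by split=> [|m mw]; apply: H; rewrite inE ?eqxx ?mw ?orbT.
by rewrite inE => /predU1P[->|/Hw].
Qed.

Lemma basis_word (g : F) : exists2 w, word_over X w & word_val w = g.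
Proof. by have [w [[Xw _ Ew] _]] := X_basis g; exists w. Qed.

Lemma basis_ind (P : F -> Prop) :
  P 1 -> (forall x g, X x -> P g -> P (x * g)) ->
  (forall x g, X x -> P g -> P (x^-1 * g)) -> forall g, P g.
Proof.
move=> P1 PM PV g; have [w Xw <-] := basis_word g.
elim: w Xw => [|[x b] w IH]; first by rewrite word_val_nil.
rewrite word_val_cons => /word_over_cons[/= Xx /IH Pw].
by case: b; [apply: PV | apply: PM].
Qed.

(** This is the universal property for maps into a symmetric group. An element acts by running its
    reduced word letter by letter; cancelling adjacent letters changes neither the value nor the
    effect of a word, so every word with that value acts alike. *)
Lemma free_action (V : Type) (alpha : F -> V -> V) :
  (forall x, bijective (alpha x)) ->
  exists2 act, is_action act & forall x, X x -> act x =1 alpha x.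
Proof.
move=> bij_alpha.
have /choice[beta /all_and2[alphaK betaK]] x :
    exists b, cancel (alpha x) b /\ cancel b (alpha x).
  by have [b Kb bK] := bij_alpha x; exists b.
pose step (l : F * bool) := if l.2 then beta l.1 else alpha l.1.
pose run w v := foldr step v w.
(* Reduction proceeds from the right: a new letter is either prepended to the reduced tail or
   cancels its head. *)
have red w : word_over X w -> exists w', [/\ word_over X w', reduced w',
    word_val w' = word_val w & run w' =1 run w].
  elim: w => [_|l w IH]; first by exists [::].
  case/word_over_cons=> Xl /IH[[|m w'] [Xw' rw' Ew' Rw']].
    exists [:: l]; split=> //.
    - exact/word_over_cons.
    - by rewrite !word_val_cons Ew'.
    - by move=> v; congr (step l _); exact: Rw'.
  have [clm|nclm] := boolP (cancelling l m); last first.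
    exists (l :: m :: w'); split=> //=.
    - exact/word_over_cons.
    - by rewrite nclm.
    - by rewrite word_val_cons Ew' -word_val_cons.
    - by move=> v; congr (step l _); exact: Rw'.
  exists w'; case/andP: clm => /eqP; case: l m Xl rw' Xw' Ew' Rw' => [x b] [y c] /=.
  move=> _ rw' /word_over_cons[_ Xw'] Ew' Rw' Exy nbc; subst y.
  split=> //.
  - exact: path_sorted rw'.
  - rewrite word_val_cons -Ew' word_val_cons /letter_val /=.
    by move: nbc; clear; case: b c => [] [] // _; rewrite mulgA ?mulVg ?mulgV mul1g.
  - move=> v; rewrite -[run (_ :: w) v]/(step (x, b) (run w v)) -Rw' /= /step /=.
    by move: nbc alphaK betaK; clear; case: b c => [] [] //= _ alphaK betaK; rewrite ?betaK ?alphaK.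
have /choice[nf /all_and2[/all_and3[Xnf rnf Enf] Unf]] g : exists w : seq (F * bool),
    [/\ word_over X w, reduced w & word_val w = g] /\
    forall w', [/\ word_over X w', reduced w' & word_val w' = g] -> w = w'.
  by have [w [? ?]] := X_basis g; exists w.
have runE w g : word_over X w -> word_val w = g -> run w =1 run (nf g).
  by move=> /red[w' [Xw' rw' Ew' Rw']] Ew v; rewrite -Rw' (Unf g w') // Ew' Ew.
exists (fun g => run (nf g)); first split=> [v|g h v].
- by rewrite -(runE [::]) // word_val_nil.
- rewrite -[RHS]foldr_cat -(runE (nf g ++ nf h)) //; last by rewrite word_val_cat !Enf.
  by move=> l; rewrite mem_cat => /orP[/Xnf|/Xnf].
- move=> x Xx v; rewrite -(runE [:: (x, false)]) //; first exact/word_over_cons.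
  by rewrite word_val_cons word_val_nil mulg1.
Qed.

End FreeGroup.

(** * Transpositions and partial injections of finite sets *)

Section Swap.
Context {T : eqType}.

Definition swap (a b v : T) : T := if v == a then b else if v == b then a else v.

Lemma swapL a b : swap a b a = b. Proof. by rewrite /swap eqxx. Qed.

Lemma swapR a b : swap a b b = a.
Proof. by rewrite /swap eqxx; case: eqP. Qed.

Lemma swap_out a b v : v != a -> v != b -> swap a b v = v.
Proof. by rewrite /swap => /negPf-> /negPf->. Qed.

Lemma swapK a b : involutive (swap a b).
Proof.
move=> v; have [->|va] := eqVneq v a; first by rewrite swapL swapR.
have [->|vb] := eqVneq v b; first by rewrite swapR swapL.
by rewrite !swap_out.
Qed.

Lemma swap_bij a b : bijective (swap a b).
Proof. exact: inv_bij (swapK a b). Qed.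

End Swap.

(** Points are treated one at a time: if [d] must go to [e], the current permutation is followed by
    the transposition of [s d] and [e]. Injectivity of [r] and of [s] keeps the values already
    prescribed. *)
Lemma partial_injection_extends (T : finType) (r : T -> T -> Prop) :
  (forall a b b', r a b -> r a b' -> b = b') ->
  (forall a a' b, r a b -> r a' b -> a = a') ->
  exists2 s : T -> T, bijective s & forall a b, r a b -> s a = b.
Proof.
move=> r_fun r_inj.
suff [s sb sP] : exists2 s : T -> T, bijective s &
    forall a, a \in enum T -> forall b, r a b -> s a = b.
  by exists s => // a b; apply: sP; rewrite mem_enum.
elim: (enum T) => [|d l [s sb sP]]; first by exists id => //; exists id.
have [[e rde]|nde] := pselect (exists e, r d e); last first.
  exists s => // a; rewrite inE => /predU1P[->|/sP//] b rdb.
  by case: nde; exists b.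
exists (swap (s d) e \o s); first exact: bij_comp (swap_bij _ _) sb.
move=> a; rewrite inE /= => /predU1P[-> b rdb|al b rab].
  by rewrite swapL; apply: r_fun rde rdb.
rewrite (sP _ al _ rab).
have [E|be] := eqVneq b e; first by
  rewrite E in rab *; rewrite -(r_inj _ _ _ rab rde) (sP _ al _ rab) swapL.
rewrite swap_out //; apply: contra be => /eqP E.
have Ead : a = d by apply: (bij_inj sb); rewrite (sP _ al _ rab).
by rewrite Ead in rab; rewrite (r_fun _ _ _ rab rde).
Qed.

(** On a finite set the inverse of an injection is one of its iterates, so closure under [s] gives
    closure under its inverse. *)
Lemma injective_closed_preim (T : finType) (s : T -> T) (P : T -> Prop) :
  injective s -> (forall a, P a -> P (s a)) -> forall a, P (s a) -> P a.
Proof.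
move=> s_inj sP a Psa; rewrite -(finv_f s_inj a) /finv.
by elim: (_.-1) => [|n IH] //=; apply: sP.
Qed.

(** * Finite truncations of coset spaces *)

Section Truncation.
Context {F : groupType} {X : set F} (X_basis : free_basis X).
Implicit Types (ws : seq (seq (F * bool))).

(** Letters act from right to left, so the tails of a word spell the initial segments of the path it
    traces from the base point. *)
Definition tail_closed ws : Prop := forall l w, l :: w \in ws -> w \in ws.

Definition words_closed ws : Prop :=
  [/\ [::] \in ws, tail_closed ws & forall w, w \in ws -> word_over X w].

Lemma words_closed_cat ws ws' :
  words_closed ws -> words_closed ws' -> words_closed (ws ++ ws').
Proof.
move=> [n t o] [n' t' o']; split; first by rewrite mem_cat n.
  by move=> l w; rewrite !mem_cat => /orP[/t->//|/t'->]; rewrite orbT.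
by move=> w; rewrite mem_cat => /orP[/o|/o'].
Qed.

Lemma words_closed_exists (K : seq F) :
  exists2 ws, words_closed ws &
    forall k, k \in K -> exists2 w, w \in ws & word_val w = k.
Proof.
elim: K => [|k K [ws ws_cl wsK]].
  exists [:: [::]] => //; split=> [//|l w|w]; first by rewrite inE.
  by rewrite inE => /eqP->.
suff [ws' ws'_cl [w ww' Ew]] : exists2 ws', words_closed ws' &
    exists2 w, w \in ws' & word_val w = k.
  exists (ws ++ ws'); first exact: words_closed_cat.
  move=> h; rewrite inE => /predU1P[->|/wsK[v vws Ev]].
    by exists w => //; rewrite mem_cat ww' orbT.
  by exists v => //; rewrite mem_cat vws.
have [w Xw <-{k}] := basis_word X_basis k.
suff [ws' ws'_cl ww'] : exists2 ws', words_closed ws' & w \in ws' by exists ws' => //; exists w.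
elim: w Xw => [_|l w IH].
  exists [:: [::]] => //; split=> [//|l w|w]; first by rewrite inE.
  by rewrite inE => /eqP->.
move=> Xlw; have /IH[ws' [n t o] ww'] := ((word_over_cons _ _).1 Xlw).2.
exists ((l :: w) :: ws'); last by rewrite inE eqxx.
split; first by rewrite inE n orbT.
  by move=> m v; rewrite !inE => /orP[/eqP[_ ->]|/t->]; rewrite ?ww' orbT.
by move=> v; rewrite inE => /predU1P[->|/o].
Qed.

(** By tail closure every intermediate point of the path lies in [D], where the action agrees with
    left translation; an inverse letter reads such an edge backwards. *)
Lemma follow {V : Type} (act : F -> V -> V) (j : F -> V) (D : set F) ws :
  is_action act -> words_closed ws -> (forall w, w \in ws -> D (word_val w)) ->
  (forall x g, X x -> D g -> D (x * g) -> act x (j g) = j (x * g)) ->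
  forall w, w \in ws -> act (word_val w) (j 1) = j (word_val w).
Proof.
move=> aP [_ t o] wsD jP; elim=> [|[x b] w IH] lws.
  by rewrite word_val_nil (act1 aP).
have := wsD _ lws; have := wsD _ (t _ _ lws).
have /word_over_cons[/= Xx _] := o _ lws.
rewrite word_val_cons (actM aP) (IH (t _ _ lws)); case: b {lws} => /= Dw Dlw.
  rewrite -[letter_val _]/(x^-1) in Dlw *.
  have := jP x (x^-1 * word_val w) Xx Dlw.
  by rewrite mulgA mulgV mul1g => /(_ Dw) <-; rewrite (actK aP).
exact: jP.
Qed.

(** For a subgroup [A], this is the union of the left cosets of [A] containing the value of a listed
    word. *)
Definition near (A : set F) ws : set F :=
  [set g | exists2 w, w \in ws & A (g^-1 * word_val w)].

Lemma near_word A ws w : subgroup A -> w \in ws -> near A ws (word_val w).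
Proof. by case/subgroupP=> A1 _ _ ww; exists w => //; rewrite mulVg. Qed.

(** [T] is the finite set of cosets met by the listed words. Left translation by [x] is a partial
    injection of [T], which extends to a permutation. *)
Lemma truncation (A : set F) ws : subgroup A -> [::] \in ws ->
  exists (T : finType) (pt : F -> T) (s : F -> T -> T),
  [/\ forall g h, near A ws g -> near A ws h -> (pt g = pt h <-> A (g^-1 * h)),
      forall x, bijective (s x),
      forall x g, near A ws g -> near A ws (x * g) -> s x (pt g) = pt (x * g) &
      forall t, exists2 w, w \in ws & t = pt (word_val w)].
Proof.
move=> sA ws0; have [A1 AM AV] := (subgroupP _).1 sA.
pose cs (g : F) : set F := [set g * a | a in A].
pose cws := [seq cs (word_val w) | w <- ws].
have c1 : cs (word_val [::]) \in cws by exact: (map_f (cs \o @word_val F)).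
pose T : finType := seq_sub cws.
(* Outside [near A ws] the value defaults to the coset of 1. *)
pose pt g : T := insubd (SeqSub c1) (cs g).
have ptE g : near A ws g -> val (pt g) = cs g.
  case=> w ww /(left_coset_eqP _ _ sA) E.
  have cg : cs g \in cws by rewrite [cs g]E; apply: (map_f (cs \o @word_val F)).
  by rewrite val_insubd cg.
have ptP g h : near A ws g -> near A ws h -> (pt g = pt h <-> A (g^-1 * h)).
  move=> ng nh; split=> [E|/(left_coset_eqP _ _ sA) E].
    by apply/(left_coset_eqP _ _ sA); rewrite -[LHS]ptE // -[RHS]ptE // E.
  by apply: val_inj; rewrite !ptE.
pose r (x : F) (a b : T) := exists g, [/\ near A ws g, near A ws (x * g), a = pt g & b = pt (x * g)].
have xK (x g h : F) : (x * g)^-1 * (x * h) = g^-1 * h by rewrite invgM -mulgA mulKg.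
have /choice[s /all_and2[s_bij sP]] x :
    exists s : T -> T, bijective s /\ forall a b, r x a b -> s a = b.
  suff [s ? ?] : exists2 s : T -> T, bijective s & forall a b, r x a b -> s a = b by exists s.
  apply: partial_injection_extends.
    move=> _ _ _ [g [ng nxg -> ->]] [h [nh nxh /(ptP _ _ ng nh) E ->]].
    by apply/ptP => //; rewrite xK.
  move=> _ _ _ [g [ng nxg -> ->]] [h [nh nxh -> /(ptP _ _ nxg nxh)]].
  by rewrite xK => /ptP->.
exists T, pt, s; split=> // [x g ng nxg|t]; first by apply: sP; exists g.
have /mapP[w ww Et] := ssvalP t; exists w => //; apply: val_inj.
by rewrite ptE //; exact: near_word.
Qed.

(** If no basis element left [near A ws], each would permute its finitely many cosets. The set would
    then be stable under inverses too, hence be all of [F], and [A] would have finite index. *)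
Lemma near_escape (A : set F) ws : subgroup A -> [::] \in ws ->
  infinite_index A [set: F] ->
  exists z w, [/\ X z, w \in ws & ~ near A ws (z * word_val w)].
Proof.
move=> sA ws0 infA; apply: contrapT => ne.
have [A1 AM AV] := (subgroupP _).1 sA.
have nM x g : X x -> near A ws g -> near A ws (x * g).
  move=> Xx [w ww Aw]; have [v vw Av] : near A ws (x * word_val w).
    by apply: contrapT => nw; apply: ne; exists x, w.
  exists v => //; have := AM _ _ Aw Av.
  by rewrite !invgM !mulgA mulgK.
have [T [pt [s [ptP s_bij sP ptT]]]] := truncation sA ws0.
(* The preimage of [pt g] under the permutation [s x] is the coset of a listed word, and that coset
   contains [x^-1 * g]. *)
have nV x g : X x -> near A ws g -> near A ws (x^-1 * g).
  move=> Xx ng; have [s' sK s'K] := s_bij x.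
  have [w ww Ew] := ptT (s' (pt g)).
  have nw := near_word sA ww.
  exists w => //; have := sP x _ nw (nM _ _ Xx nw); rewrite -Ew s'K.
  by move/(ptP _ _ ng (nM _ _ Xx nw)); rewrite invgM invgK -mulgA.
have all_near : forall g, near A ws g.
  apply: (basis_ind X_basis) => //; rewrite -(@word_val_nil F).
  exact: near_word.
apply: infA.
apply: (@sub_finite_set _ _ [set` [seq [set word_val w * a | a in A] | w <- ws]]); last exact: finite_seq.
move=> _ [g _ <-] /=; have [w ww /(left_coset_eqP _ _ sA)->] := all_near g.
by apply: map_f.
Qed.

End Truncation.

(** * Counting in finite transitive actions *)

(* In a transitive finite action the elements mapping x to y make up a
   proportion 1 / #|T| of the whole group. *)
Lemma transitive_avoid (G : groupType) (T : finType) (act : G -> T -> T) :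
  is_action act -> (forall x y, exists g, act g x = y) ->
  forall L : seq (T * T), size L < #|T| ->
  exists g, forall x y, (x, y) \in L -> act g x != y.
Proof.
move=> aP tr L ltLT; apply: contrapT => bad.
(* [G] may be infinite, so the counting takes place in its finite image among the maps from [T] to
   itself. *)
pose img : pred {ffun T -> T} := fun s => `[< exists g, s = finfun (act g) >].
pose N x y := \sum_(s | img s) (s x == y : nat).
have NE x y y' : N x y = N x y'.
  have [h hy] := tr y y'.
  pose m g (s : {ffun T -> T}) : {ffun T -> T} := [ffun t => act g (s t)].
  have mK g : cancel (m g) (m g^-1).
    by move=> s; apply/ffunP=> t; rewrite !ffunE (actK aP).
  have mVK g : cancel (m g^-1) (m g).
    by move=> s; apply/ffunP=> t; rewrite !ffunE (actVK aP).
  have img_m g s : img s -> img (m g s).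
    case/asboolP=> k ->; apply/asboolP; exists (g * k).
    by apply/ffunP=> t; rewrite !ffunE (actM aP).
  rewrite [RHS](reindex (m h)) /=; last by exists (m h^-1) => s _; [exact: mK | exact: mVK].
  apply: eq_big => s; last first.
    by rewrite ffunE -hy (inj_eq (can_inj (actK aP h))).
  by apply/idP/idP => [|/(img_m h^-1)]; [exact: img_m | rewrite mK].
have TN x y : (#|T| * N x y)%N = \sum_(s | img s) 1.
  rewrite -sum_nat_const (eq_bigr (N x)) => [|y' _]; last exact: NE.
  rewrite exchange_big; apply: eq_bigr => s _.
  by rewrite (bigD1 (s x)) //= eqxx big1 ?addn0 // => y' /negPf; rewrite eq_sym => ->.
(* If no [g] avoided [L], every map in the image would satisfy some pair of [L], whence this union
   bound; multiplied by the size of [T] it contradicts [size L < #|T|]. *)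
have imgL : \sum_(s | img s) 1 <= \sum_(p <- L) N p.1 p.2.
  rewrite exchange_big; apply: leq_sum => s /asboolP[g ->].
  apply: contrapT => /negP; rewrite -ltnNge ltnS leqn0 sum_nat_seq_eq0 => /allP L0.
  by apply: bad; exists g => x y /L0 /=; rewrite ffunE eqb0.
have img_gt0 : 0 < \sum_(s | img s) 1.
  by rewrite (bigD1 [ffun t => act 1 t]) //=; apply/asboolP; exists 1.
have := leq_mul (leqnn #|T|) imgL.
rewrite [leqRHS]big_distrr /= [leqRHS](eq_bigr (fun=> \sum_(s | img s) 1)) => [|p _]; last exact: TN.
by rewrite [leqRHS]big_const_seq count_predT iter_addn_0 mulnC leq_pmul2l // leqNgt ltLT.
Qed.

(** * A finite action with a point outside prescribed double cosets *)

Section Construction.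
Context {F : groupType} {X : set F} (X_basis : free_basis X).

Lemma generated_sub (K : seq F) (H M : set F) :
  H = generated [set` K] -> subgroup M -> (forall k, k \in K -> M k) -> H `<=` M.
Proof. by move=> -> sM KM; apply: smallest_sub. Qed.

Lemma generated_mem (K : seq F) (H : set F) k :
  H = generated [set` K] -> k \in K -> H k.
Proof. by move=> -> kK; apply: sub_gen_smallest. Qed.

(** On the truncation [T] the subgroup [B] fixes [pt 1], so [p b q] takes [q^-1 (pt 1)] to
    [p (pt 1)]. If [T] has more than [size P * size Q] points, some [f] does so for no pair [p],
    [q]. *)
Lemma finite_action_missing_double_cosets (B : set F) (KB P Q : seq F) :
  subgroup B -> B = generated [set` KB] -> infinite_index B [set: F] ->
  exists (C : finType) (act : F -> C -> C) (c : C) (f : F), is_action act /\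
    forall p b q, p \in P -> B b -> q \in Q -> act (p * b * q) c != act f c.
Proof.
move=> sB EB infB; have [B1 BM BV] := (subgroupP _).1 sB.
have [E EB' ltE] := infinite_set_fset (size P * size Q)%N.+1 infB.
have /choice[rep repP] Y : exists g, left_cosets B setT Y -> Y = [set g * b | b in B].
  have [[g _ <-]|nY] := pselect (left_cosets B setT Y); first by exists g.
  by exists 1.
(* Listing words for representatives of more than [size P * size Q] cosets forces [T] to be large
   enough. *)
pose K := [seq rep Y | Y <- finmap.enum_fset E].
have [ws wsC wsK] := words_closed_exists X_basis (K ++ KB).
have [ws0 _ _] := wsC.
have [T [pt [s [ptP s_bij sP ptT]]]] := truncation sB ws0.
have [act aP actX] := free_action X_basis s_bij.
have run w : w \in ws -> act (word_val w) (pt 1) = pt (word_val w).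
  apply: (follow (D := near B ws) aP wsC) => [v vw|x g Xx ng nxg]; first exact: near_word sB _.
  by rewrite actX //; apply: sP.
have nK k : k \in K ++ KB -> near B ws k.
  by case/wsK=> w ww <-; apply: near_word sB _.
have n1 : near B ws 1 by rewrite -(@word_val_nil F); apply: near_word sB _.
have Bfix b : B b -> act b (pt 1) = pt 1.
  apply: (generated_sub EB (stab_subgroup aP (pt 1))) => k kKB.
  have kK : k \in K ++ KB by rewrite mem_cat kKB orbT.
  have [w ww Ew] := wsK k kK.
  rewrite /stab /= -Ew (run w ww) Ew; apply/ptP => //; first exact: nK.
  by rewrite mulg1; apply/BV/(generated_mem EB).
have ltT : (size P * size Q)%N < #|T|.
  have -> : #|T| = size (enum T) by rewrite cardT.
  apply: leq_trans ltE _; rewrite -(size_map (pt \o rep)).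
  apply: uniq_leq_size => [|t _]; last by rewrite mem_enum.
  rewrite map_inj_in_uniq ?finmap.fset_uniq // => Y Y' YE Y'E /= /ptP.
  have nrep Z : Z \in finmap.enum_fset E -> near B ws (rep Z).
    by move=> ZE; apply: nK; rewrite mem_cat map_f.
  move=> /(_ (nrep _ YE) (nrep _ Y'E)) /(left_coset_eqP _ _ sB).
  by rewrite -(repP Y (EB' _ YE)) -(repP Y' (EB' _ Y'E)).
have tr x y : exists g, act g x = y.
  have [[v vw ->] [w ww ->]] := (ptT x, ptT y).
  exists (word_val w * (word_val v)^-1).
  by rewrite (actM aP) -!run // (actK aP).
pose L := [seq (act q^-1 (pt 1), act p (pt 1)) | p <- P, q <- Q].
have [|f fP] := transitive_avoid aP tr (L := L); first by rewrite size_allpairs.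
(* With the identity map as [c], two elements agree at [c] exactly when they act alike on all of
   [T]. *)
exists {ffun T -> T}, (fun g (s : {ffun T -> T}) => [ffun t => act g (s t)]), [ffun t => t], f.
split=> [|p b q pP Bb qQ].
  by split=> [v|g h v]; apply/ffunP=> t; rewrite !ffunE ?(act1 aP) ?(actM aP).
apply/eqP => /ffunP/(_ (act q^-1 (pt 1))); rewrite !ffunE => E1.
have /fP/eqP[] : (act q^-1 (pt 1), act p (pt 1)) \in L by apply: allpairs_f.
by rewrite -E1 !(actM aP) (actVK aP) Bfix.
Qed.

End Construction.

(** * Splicing [T], [C] and the line of integers *)

Section Splice.
Context {F : groupType} {X : set F} (X_basis : free_basis X).
Context {T C : finType} (s : F -> T -> T) (s_bij : forall x, bijective (s x)).
Context (actC : F -> C -> C) (actC_action : is_action actC).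
Context (z : F) (t : T) (c u : C) (u_neq_c : u != c) (Xz : X z).

Let V : eqType := (T + C + int)%type.
Let vT (a : T) : V := inl (inl a).
Let vC (d : C) : V := inl (inr d).
Let vZ (k : int) : V := inr k.

Definition unspliced_move (x : F) (v : V) : V :=
  match v with
  | inl (inl a) => vT (s x a)
  | inl (inr d) => vC (actC x d)
  | inr k => vZ (k + 1)%R
  end.

(* The z-edges leaving t and c exchange their targets, and so do those leaving
   u and 0: the former joins T to C, the latter inserts the line of integers
   into an edge of C. *)
Definition splice_move (x : F) (v : V) : V :=
  unspliced_move x
    (if x == z then swap (vT t) (vC c) (swap (vC u) (vZ 0%R) v) else v).

Lemma splice_move_bij x : bijective (splice_move x).
Proof.
have unspliced_bij : bijective (unspliced_move x).
  have [s' sK s'K] := s_bij x.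
  exists (fun v : V => match v with
    | inl (inl a) => vT (s' a) | inl (inr d) => vC (actC x^-1 d)
    | inr k => vZ (k - 1)%R end).
  - by case=> [[a|d]|k] /=; rewrite ?sK ?(actK actC_action) ?GRing.addrK.
  - by case=> [[a|d]|k] /=; rewrite ?s'K ?(actVK actC_action) ?GRing.subrK.
rewrite /splice_move; have [_|_] := eqVneq x z; last exact: unspliced_bij.
exact: bij_comp unspliced_bij (bij_comp (swap_bij _ _) (swap_bij _ _)).
Qed.

(** As [u] differs from [c], the two transpositions have disjoint supports, so the exchanges do not
    interfere. *)
Lemma splice_moveE x v : splice_move x v =
  match v with
  | inl (inl a) => if (x == z) && (a == t) then vC (actC x c) else vT (s x a)
  | inl (inr d) => if (x == z) && (d == u) then vZ 1%R
                   else if (x == z) && (d == c) then vT (s x t) else vC (actC x d)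
  | inr k => if (x == z) && (k == 0%R) then vC (actC x u) else vZ (k + 1)%R
  end.
Proof.
rewrite /splice_move; case: eqP => _; last by case: v => [[]|].
rewrite /swap; case: v => [[a|d]|k].
- have -> : (inl (inl a) : V) == vC u = false by [].
  have -> : (inl (inl a) : V) == vZ 0%R = false by [].
  have -> : ((inl (inl a) : V) == vT t) = (a == t) by [].
  by case: eqP.
- have -> : ((inl (inr d) : V) == vC u) = (d == u) by [].
  have [_|_] := eqVneq d u; first by rewrite /=.
  have -> : (inl (inr d) : V) == vT t = false by [].
  have -> : ((inl (inr d) : V) == vC c) = (d == c) by [].
  by case: eqP.
- have -> : (inr k : V) == vC u = false by [].
  have -> : ((inr k : V) == vZ 0%R) = (k == 0%R) by [].
  have [_|_] := eqVneq k 0%R; last by rewrite /=.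
  have -> : vC u == vT t = false by [].
  have -> : (vC u == vC c) = (u == c) by [].
  by rewrite (negPf u_neq_c).
Qed.

Context (act : F -> V -> V) (act_action : is_action act).
Context (actX : forall x, X x -> act x =1 splice_move x).

Let actE x v (Xx : X x) := etrans (actX Xx v) (splice_moveE x v).

(** From [t] the orbit enters [C] at [z c]. If it missed [u], its trace on [C] would be stable under
    every basis element, and by finiteness under [F], so it would contain [f c = u]. From [u],
    powers of [z] run along the line forever. *)
Lemma splice_orbit_infinite (o : V) f :
  actC f c = u -> (exists g, act g o = vT t) ->
  infinite_set [set act g o | g in setT].
Proof.
move=> fc [g0 g0o] finO; pose R : set V := [set act g o | g in setT].
have RM g v : R v -> R (act g v).
  by case=> h _ <-; exists (g * h) => //; rewrite (actM act_action).
have Rzc : R (vC (actC z c)).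
  have := actE (vT t) Xz; rewrite eqxx /= eqxx => <-.
  by apply: RM; exists g0.
have Ru : R (vC u).
  apply: contrapT => nRu.
  have RX x d : X x -> R (vC d) -> R (vC (actC x d)).
    move=> Xx Rd; have := actE (vC d) Xx => /=.
    have [Ed|_] := eqVneq d u; first by rewrite -Ed in nRu.
    rewrite andbF; have [Ed|_] := eqVneq d c; last first.
      by rewrite andbF => <-; apply: RM.
    by have [->|_] := eqVneq x z => /= [_|<-]; [rewrite Ed | apply: RM].
  have RV x d : X x -> R (vC d) -> R (vC (actC x^-1 d)).
    move=> Xx Rd.
    apply: (injective_closed_preim (can_inj (actK actC_action x))
              (P := fun d => R (vC d))) => [e|]; first exact: RX.
    by rewrite (actVK actC_action).
  have RC : forall g d, R (vC d) -> R (vC (actC g d)).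
    apply: (basis_ind X_basis) => [d|x g Xx IH d /IH|x g Xx IH d /IH].
    - by rewrite (act1 actC_action).
    - by rewrite (actM actC_action); apply: RX.
    - by rewrite (actM actC_action); apply: RV.
  by have := RC (f * z^-1) _ Rzc; rewrite (actM actC_action) (actK actC_action) fc.
(* The spliced edge from [u] enters the line at 1, so only positive integers are claimed. *)
have RZ n : R (vZ n.+1).
  elim: n => [|n IH].
    by have := actE (vC u) Xz; rewrite eqxx /= eqxx => <-; apply: RM.
  have := actE (vZ n.+1) Xz; rewrite eqxx /= => E.
  by have := RM z _ IH; rewrite E /vZ -PoszD addn1.
apply: infinite_nat.
apply: sub_finite_set (finite_image (fun v : V => if v is inr (Posz n) then n.-1 else 0) finO).
by move=> n _; exists (vZ n.+1) => //; apply: RZ.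
Qed.

(** * Finiteness of the [B]-orbits starting in [T] *)

Section FiniteOrbit.
Context (B : set F) (B_subgroup : subgroup B) (KB : seq F).
Context (B_gen : B = generated [set` KB]) (ws : seq (seq (F * bool))).
Context (ws_closed : words_closed (X := X) ws).
Context (wsKB : forall k, k \in KB ->
  (exists2 w, w \in ws & word_val w = k) /\ (exists2 w, w \in ws & word_val w = k^-1)).

Let P : seq F := [seq word_val w | w <- ws].
(** From [T] one enters [C] either at [c], along [z^-1], or at [z c], along [z]. After reading [p]
    these points are [p q c] with [q = p^-1] or [q = p^-1 z], hence the two halves. *)
Let Q : seq F := [seq q^-1 | q <- P] ++ [seq q^-1 * z | q <- P].
Context (missing : forall p b q, p \in P -> B b -> q \in Q -> actC (p * b * q) c != u).

(* The points a B-word may occupy once its last generator has been read up to p. *)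
Let reach (p : F) : set V := fun v => match v with
  | inl (inl _) => True
  | inl (inr d) => exists b q, [/\ B b, q \in Q & d = actC (p * b * q) c]
  | inr _ => False
  end.

Let B1 : B 1. Proof. by have [] := (subgroupP _).1 B_subgroup. Qed.

Lemma reach_enter p : p \in P -> reach p (vC c).
Proof.
move=> pP; exists 1, p^-1; split=> //; first by rewrite mem_cat map_f.
by rewrite mulg1 mulgV (act1 actC_action).
Qed.

Lemma reach_enter_z p : p \in P -> reach p (vC (actC z c)).
Proof.
move=> pP; exists 1, (p^-1 * z); split=> //.
  by rewrite mem_cat [X in _ || X]map_f ?orbT.
by rewrite mulg1 mulgA mulgV mul1g.
Qed.

Lemma reach_avoids p : p \in P -> ~ reach p (vC u).
Proof. by move=> pP [b [q [Bb qQ E]]]; have := missing pP Bb qQ; rewrite -E eqxx. Qed.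

Lemma reach_step x p v : X x -> x * p \in P -> p \in P ->
  reach p v -> reach (x * p) (act x v).
Proof.
move=> Xx xpP pP; rewrite actE //; case: v => [[a _|d pd]|//].
  case: ifP => // /andP[/eqP Ex _]; rewrite Ex in xpP *; exact: reach_enter_z.
have [E|_] := eqVneq d u; first by rewrite E in pd; case: (reach_avoids pP pd).
rewrite andbF; case: ifP => // _.
have [b [q [Bb qQ ->]]] := pd; exists b, q; split=> //.
by rewrite -(actM actC_action) !mulgA.
Qed.

(** The edge is examined from its source, the point arrived at. A source [u], or a source 0 on a
    spliced edge, would put [u] among the reachable points or require starting on the line. *)
Lemma reach_stepV x p v : X x -> x^-1 * p \in P -> p \in P ->
  reach p v -> reach (x^-1 * p) (act x^-1 v).
Proof.
move=> Xx xpP pP; rewrite -{1}(actVK act_action x v).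
move: (act x^-1 v) => {}v; rewrite actE //.
have back d : reach p (vC (actC x d)) -> reach (x^-1 * p) (vC d).
  move=> [b [q [Bb qQ E]]]; exists b, q; split=> //.
  by rewrite -!mulgA (actM actC_action) !mulgA -E (actK actC_action).
case: v => [[//|d]|k].
  have [->|du] := eqVneq d u; rewrite ?andbT ?andbF.
    case: ifP => //= _; rewrite (negPf u_neq_c) andbF.
    by move=> /back/(reach_avoids xpP).
  case: ifP => [/andP[_ /eqP->] _|_]; first exact: reach_enter.
  exact: back.
by case: ifP => // _ /back/(reach_avoids xpP).
Qed.

(** The set [reach 1] contains [T], lies in the finite set [T + C], and is shown to be stable under
    [B]. *)
Lemma splice_orbit_finite a : finite_set [set act b (vT a) | b in B].
Proof.
have [ws0 ws_tl ws_X] := ws_closed.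
have run w v : w \in ws -> reach 1 v -> reach (word_val w) (act (word_val w) v).
  elim: w => [_|[x b] w IH] lws; first by rewrite word_val_nil (act1 act_action).
  have ww := ws_tl _ _ lws; move/(IH ww).
  have /word_over_cons[/= Xx _] := ws_X _ lws.
  have := map_f (@word_val F) lws; have := map_f (@word_val F) ww.
  rewrite word_val_cons (actM act_action).
  by case: b {lws} => wP lwP; [apply: reach_stepV | apply: reach_step].
have [_ BM BV] := (subgroupP _).1 B_subgroup.
(* A word with value [k] in [B] leads to points [k b q c]; absorbing [k] into [b] returns to
   [reach 1]. *)
have runB w v : w \in ws -> B (word_val w) -> reach 1 v -> reach 1 (act (word_val w) v).
  move=> ww Bw /(run _ _ ww); move: (act _ v) => [[//|d]|//] [b [q [Bb qQ ->]]].
  by exists (word_val w * b), q; split; [apply: BM| |rewrite mul1g].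
pose M : set F := [set g | forall v, reach 1 v -> reach 1 (act g v) /\ reach 1 (act g^-1 v)].
have sM : subgroup M.
  apply/subgroupP; split=> [v Iv|g h Mg Mh v Iv|g Mg v Iv].
  - by rewrite invg1 (act1 act_action).
  - rewrite invgM !(actM act_action); split; first exact: (Mg _ (Mh _ Iv).1).1.
    exact: (Mh _ (Mg _ Iv).2).2.
  - by rewrite invgK; have [] := Mg v Iv.
have BsM : B `<=` M.
  apply: (generated_sub B_gen sM) => k kK v Iv.
  have Bk := generated_mem B_gen kK.
  have [[w ww Ew] [w' ww' Ew']] := wsKB kK.
  split; first by rewrite -Ew; apply: runB => //; rewrite Ew.
  by rewrite -Ew'; apply: runB => //; rewrite Ew'; apply: BV.
apply: (@sub_finite_set _ _ [set inl e | e in [set: (T + C)%type]]).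
  move=> _ [b Bb <-]; have [] := BsM b Bb (vT a) I.
  by case: (act b _) => [e _ _|//]; exists e.
exact/finite_image/finite_finset.
Qed.

End FiniteOrbit.
End Splice.

(** * Assembling the action and deducing the theorem *)

Lemma separating_action (F : groupType) (X : set F) (A B : set F) (KA KB S : seq F) :
  free_basis X -> subgroup A -> subgroup B ->
  A = generated [set` KA] -> B = generated [set` KB] ->
  infinite_index A [set: F] -> infinite_index B [set: F] ->
  (forall g, g \in S -> ~ A g) ->
  exists (V : Type) (act : F -> V -> V) (o : V),
  [/\ is_action act, A `<=` stab act o, forall g, g \in S -> ~ stab act o g,
      finite_set [set act b o | b in B] & infinite_set [set act g o | g in setT]].
Proof.
move=> X_basis sA sB EA EB infA infB SA.
have [A1 AM AV] := (subgroupP _).1 sA.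
have [wsA wsAC wsAK] := words_closed_exists X_basis (KA ++ S).
have [wsA0 _ _] := wsAC.
have [z [w0 [Xz w0A zw0]]] := near_escape X_basis sA wsA0 infA.
have [T [pt [s [ptP s_bij sP _]]]] := truncation sA wsA0.
have [wsB wsBC wsBK] := words_closed_exists X_basis (KB ++ [seq k^-1 | k <- KB]).
pose P := [seq word_val w | w <- wsB].
pose Q := [seq q^-1 | q <- P] ++ [seq q^-1 * z | q <- P].
have [C [actC [c [f [aC miss]]]]] := finite_action_missing_double_cosets X_basis P Q sB EB infB.
have P1 : 1 \in P by rewrite -(@word_val_nil F) map_f //; case: wsBC.
(* Since 1 lies in [P], [B] and [Q], the point [c] is itself among the excluded ones. *)
have u_neq_c : actC f c != c.
  have Q1 : 1 \in Q by rewrite mem_cat -[1]invg1 map_f.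
  have := miss 1 1 1 P1 _ Q1; rewrite !mulg1 (act1 aC) eq_sym; apply.
  by have [] := (subgroupP _).1 sB.
pose t := pt (word_val w0).
have [act aP actX] := free_action X_basis (splice_move_bij s_bij aC z t c (actC f c)).
pose j g : (T + C + int)%type := inl (inl (pt g)).
have near_w w : w \in wsA -> near A wsA (word_val w) by apply: near_word.
have n1 : near A wsA 1 by rewrite -(@word_val_nil F); apply: near_w.
have run w : w \in wsA -> act (word_val w) (j 1) = j (word_val w).
  apply: (follow (D := near A wsA) aP wsAC near_w) => x g Xx ng nxg.
  rewrite actX // splice_moveE //; case: ifP => [/andP[/eqP Ex /eqP]|_]; last by rewrite sP.
  move=> /(ptP _ _ ng (near_w _ w0A)) Agw; case: zw0; rewrite -Ex.
  have [v vw Av] := nxg; exists v => //.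
  have := AM _ _ (AV _ Agw) Av.
  by rewrite !invgM invgK !mulgA mulgK.
exists (T + C + int)%type, act, (j 1); split=> //.
- apply: (generated_sub EA (stab_subgroup aP _)) => k kK.
  have [|w ww Ew] := wsAK k; first by rewrite mem_cat kK.
  rewrite /stab /= -Ew run // /j; do 2 congr inl; apply/ptP => //; first exact: near_w.
  by rewrite Ew mulg1; apply/AV/(generated_mem EA).
- move=> g gS; have [|w ww Ew] := wsAK g; first by rewrite mem_cat gS orbT.
  rewrite /stab /= -Ew run // /j => -[] /(ptP _ _ (near_w _ ww) n1).
  by rewrite mulg1 Ew => /AV; rewrite invgK; apply: SA.
- apply: (splice_orbit_finite aC u_neq_c aP actX sB EB wsBC) => [k kK|p b q].
    by split; apply: wsBK; rewrite mem_cat ?kK // map_f ?orbT.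
  exact: miss.
- apply: (splice_orbit_infinite X_basis aC u_neq_c Xz aP actX (f := f)) => //.
  by exists (word_val w0); rewrite run.
Qed.

Theorem theorem1p1 (F : groupType) (F_free : free_group F) (A B : set F)
    (A_subgroup : subgroup A) (B_subgroup : subgroup B)
    (A_fg : finitely_generated A) (B_fg : finitely_generated B)
    (A_index : infinite_index A [set: F])
    (B_index : infinite_index B [set: F]) :
  (exists H : set F,
     [/\ subgroup H, H `<=` B, finite_index H B
       & infinite_index (generated (A `|` H)) [set: F]])
  /\
  (forall S : set F, finite_set S -> S `<=` ~` A ->
     exists H : set F,
       [/\ subgroup H, H `<=` B, finite_index H B,
           infinite_index (generated (A `|` H)) [set: F]
         & generated (A `|` H) `&` S = set0]).
Proof.
suff main (S : set F) : finite_set S -> S `<=` ~` A -> exists H : set F,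
       [/\ subgroup H, H `<=` B, finite_index H B,
           infinite_index (generated (A `|` H)) [set: F]
         & generated (A `|` H) `&` S = set0].
  split=> //; have [|//|H [? ? ? ? _]] := main set0; first exact: finite_set0.
  by exists H.
move=> /finite_seqP[KS ES] SA.
have [X X_basis] := F_free.
have [_ /finite_seqP[KA ->] EA] := A_fg.
have [_ /finite_seqP[KB ->] EB] := B_fg.
have [|V [act [o [aP Ao So finB infF]]]] :=
    separating_action (S := KS) X_basis A_subgroup B_subgroup EA EB A_index B_index.
  by move=> g gS; apply: SA; rewrite ES.
have so := stab_subgroup aP o.
have [B1 BM BV] := (subgroupP _).1 B_subgroup.
have [o1 oM oV] := (subgroupP _).1 so.
have gen_stab : generated (A `|` (B `&` stab act o)) `<=` stab act o.
  by apply: smallest_sub => // g [/Ao|[]].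
exists (B `&` stab act o); split.
- apply/subgroupP; split=> // [g h [Bg og] [Bh oh]|g [Bg og]].
    by split; [apply: BM | apply: oM].
  by split; [apply: BV | apply: oV].
- by move=> g [].
- exact: stab_finite_index.
- apply: stab_infinite_index gen_stab infF => //.
  by apply: sub_gen_smallest; right.
- by apply/seteqP; split=> // g [/gen_stab og]; rewrite ES => /So; apply.
Qed.
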